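(* Let $N\ge 1$ be an integer and let $\xi_1,\dots,\xi_N>0$ be real constants. The global optimal solution of the problem $$\min_{\alpha_1,\dots,\alpha_N\ge 0}\ \sum_{n=1}^N\frac{\xi_n}{\alpha_n}\quad\text{subject to}\quad\sum_{n=1}^N\alpha_n=1$$ is $$\alpha_n^\star=\frac{\sqrt{\xi_n}}{\sum_{m=1}^N\sqrt{\xi_m}},\qquad n=1,\dots,N.$$
   Context: The convention $\xi_n/0=+\infty$ is used, so that feasible points with some $\alpha_n=0$ have infinite objective value. *)

(* Defs.v *)
From HB Require Import structures.
From mathcomp Require Import all_boot all_order all_algebra.
From mathcomp Require Import all_classical all_reals.

Set Implicit Arguments.
Unset Strict Implicit.
Unset Printing Implicit Defensive.

Import Order.TTheory GRing.Theory Num.Theory.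

Local Open Scope classical_set_scope.
Local Open Scope ring_scope.

Definition global_minimizer (R : realType) (T : Type) (S : set T)
    (f : T -> \bar R) (x : T) : Prop :=
  S x /\ forall y, S y -> (f x <= f y)%E.

Definition feasible (R : realType) (N : nat) : set 'rV[R]_N :=
  [set alpha | (forall n, 0 <= alpha 0 n) /\ \sum_(n < N) alpha 0 n = 1].

(* Division in [\bar R]: [0^-1 = +oo], hence [x%:E / 0 = +oo] for [0 < x];
   division in [R] would give [x / 0 = 0]. *)
Definition objective (R : realType) (N : nat) (xi alpha : 'rV[R]_N) : \bar R :=
  (\sum_(n < N) (xi 0%R n)%:E / (alpha 0%R n)%:E)%E.

Definition alpha_star (R : realType) (N : nat) (xi : 'rV[R]_N) : 'rV[R]_N :=
  \row_(n < N) (Num.sqrt (xi 0 n) / \sum_(m < N) Num.sqrt (xi 0 m)).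

(* Main.v *)
Require Import Defs.
From HB Require Import structures.
From mathcomp Require Import all_boot all_order all_algebra.
From mathcomp Require Import all_classical all_reals.
From mathcomp Require Import ring.

(** Write [S] for the sum of the [sqrt xi_n].  When every [alpha_n] is positive
    and they sum to [1], completing squares gives
    [sum xi_n / alpha_n = S^2 + sum (sqrt xi_n - S alpha_n)^2 / alpha_n],
    so the objective is at least [S^2], with equality exactly when every
    [alpha_n] is [sqrt xi_n / S]; a vanishing [alpha_n] makes it infinite. *)

Set Implicit Arguments.
Unset Strict Implicit.
Unset Printing Implicit Defensive.

Import Order.TTheory GRing.Theory Num.Theory.
Local Open Scope classical_set_scope.
Local Open Scope ring_scope.

Lemma sum_sqr_div_eq (F : fieldType) (I : finType) (s a : I -> F) :
    (forall i, a i != 0) -> \sum_i a i = 1 ->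
  \sum_i s i ^+ 2 / a i =
  (\sum_i s i) ^+ 2 + \sum_i (s i - (\sum_j s j) * a i) ^+ 2 / a i.
Proof.
move=> a0 a1.
(* The coefficient stays a variable [c] so that it is not itself expanded as a sum; at
   [c = \sum_j s j] the last two terms combine to [- c ^+ 2]. *)
have complete_square c : \sum_i (s i - c * a i) ^+ 2 / a i =
    \sum_i s i ^+ 2 / a i - (2 * c) * (\sum_i s i) + c ^+ 2 * (\sum_i a i).
  rewrite !mulr_sumr -sumrB -big_split /=.
  by apply: eq_bigr => i _; field.
by rewrite complete_square a1; ring.
Qed.

Section Objective.
Variables (R : realType) (N : nat) (xi : 'rV[R]_N).
Hypothesis xi_gt0 : forall n, 0 < xi 0 n.

Let S := \sum_(n < N) Num.sqrt (xi 0 n).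

(** The term at [n] is [+oo], and the others, being nonnegative, cannot be [-oo], which would absorb
    it. *)
Lemma objective_pinfty (a : 'rV[R]_N) (n : 'I_N) :
  (forall m, 0 <= a 0 m) -> a 0 n = 0 -> objective xi a = +oo%E.
Proof.
move=> a_ge0 an0.
have term_ge0 m : (0 <= (xi 0 m)%:E / (a 0 m)%:E)%E.
  by apply: mule_ge0; rewrite ?inve_ge0 lee_fin // ltW.
apply/esum_eqyP => [m _|]; first by rewrite gt_eqF// (lt_le_trans (ltNyr 0)).
by exists n; split=> //; rewrite an0 inve0 gt0_muley ?lte_fin.
Qed.

(** At positive entries the extended inverse is the real one, so the identity above applies with the
    square roots of [xi] as [s]. *)
Lemma objective_fin (a : 'rV[R]_N) :
    (forall n, 0 < a 0 n) -> \sum_(n < N) a 0 n = 1 ->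
  objective xi a =
  (S ^+ 2 + \sum_(n < N) (Num.sqrt (xi 0 n) - S * a 0 n) ^+ 2 / a 0 n)%:E.
Proof.
move=> a_gt0 a1; rewrite -sum_sqr_div_eq// => [|n]; last by rewrite gt_eqF.
rewrite -sumEFin; apply: eq_bigr => n _.
by rewrite inver gt_eqF// sqr_sqrtr // ltW.
Qed.

Hypothesis N_gt0 : (0 < N)%N.

Lemma sum_sqrt_gt0 : 0 < S.
Proof.
rewrite /S (bigD1 (Ordinal N_gt0)) //= ltr_pwDl ?sqrtr_gt0//.
by apply: sumr_ge0 => n _; exact: sqrtr_ge0.
Qed.

Lemma alpha_star_gt0 n : 0 < alpha_star xi 0 n.
Proof. by rewrite mxE divr_gt0 ?sqrtr_gt0 ?sum_sqrt_gt0. Qed.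

Lemma sum_alpha_star : \sum_(n < N) alpha_star xi 0 n = 1.
Proof.
under eq_bigr do rewrite mxE.
by rewrite -mulr_suml divff // gt_eqF ?sum_sqrt_gt0.
Qed.

Lemma alpha_star_feasible : feasible (alpha_star xi).
Proof. by split=> [n|]; [exact/ltW/alpha_star_gt0|exact: sum_alpha_star]. Qed.

(** Multiplying [alpha_star] by [S] gives back the square roots, so every completed square
    vanishes. *)
Lemma objective_alpha_star : objective xi (alpha_star xi) = (S ^+ 2)%:E.
Proof.
rewrite objective_fin; [|exact: alpha_star_gt0|exact: sum_alpha_star].
rewrite big1 ?addr0// => n _.
by rewrite mxE [S * _]mulrC divfK ?subrr ?expr0n ?mul0r// gt_eqF ?sum_sqrt_gt0.
Qed.

Lemma objective_ge (a : 'rV[R]_N) : feasible a -> ((S ^+ 2)%:E <= objective xi a)%E.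
Proof.
move=> [a_ge0 a1].
have [a_gt0|/existsNP[n /negP]] := pselect (forall n, 0 < a 0 n); last first.
  (* A feasible entry that is not positive is zero, so the objective is [+oo]. *)
  rewrite -leNgt => an_le0.
  by rewrite (@objective_pinfty _ n) ?leey//; apply/le_anti/andP.
rewrite objective_fin// lee_fin lerDl sumr_ge0// => n _.
by rewrite divr_ge0 ?sqr_ge0.
Qed.

Lemma objective_le_eq (a : 'rV[R]_N) :
  feasible a -> (objective xi a <= (S ^+ 2)%:E)%E -> a = alpha_star xi.
Proof.
move=> [a_ge0 a1].
have [a_gt0|/existsNP[n /negP]] := pselect (forall n, 0 < a 0 n); last first.
  rewrite -leNgt => an_le0.
  by rewrite (@objective_pinfty _ n)//; apply/le_anti/andP.
have defect_ge0 (n : 'I_N) :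
    true -> 0 <= (Num.sqrt (xi 0 n) - S * a 0 n) ^+ 2 / a 0 n.
  by rewrite divr_ge0 ?sqr_ge0.
rewrite objective_fin// lee_fin gerDl => sum_le0.
(* The sum of the nonnegative defects is zero, hence so is each defect; this forces [S * a 0 n] to
   be the square root of [xi 0 n]. *)
have /eqP := le_anti (introT andP (conj sum_le0 (sumr_ge0 _ defect_ge0))).
rewrite psumr_eq0// => /allP defect0.
apply/rowP => n; rewrite mxE.
have := defect0 n (mem_index_enum n).
rewrite /= mulf_eq0 invr_eq0 (gt_eqF (a_gt0 n)) orbF sqrf_eq0 subr_eq0 => /eqP ->.
by rewrite mulrC mulKf// gt_eqF ?sum_sqrt_gt0.
Qed.

End Objective.

Theorem mainTheorem4 (R : realType) (N : nat) (hN : (1 <= N)%N)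
    (xi : 'rV[R]_N) (hxi : forall n : 'I_N, 0 < xi 0 n) (alpha : 'rV[R]_N) :
  global_minimizer (@feasible R N) (objective xi) alpha <->
  alpha = alpha_star xi.
Proof.
split=> [[alpha_feas alpha_min]|->].
  (* Comparing the minimizer with the feasible point [alpha_star xi] bounds its value by the square
     of the sum of roots. *)
  apply: objective_le_eq => //; rewrite -objective_alpha_star//.
  exact/alpha_min/alpha_star_feasible.
split=> [|a a_feas]; first exact: alpha_star_feasible.
by rewrite objective_alpha_star//; exact: objective_ge.
Qed.
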